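(* Let $q\ge3$ be prime and let $S\subseteq\mathbb{F}_q$ with $|S|=\frac{q-1}{2}$ be such that the stabilizer of the vertex $(0,0)$ in $\mathrm{Aut}(G_S)$ equals $\{v\mapsto\lambda v:\lambda\in\mathbb{F}_q^*\}$. Then $\chi_D(G_S)=q+1$.
   Context: The graph $G_S$ has vertex set $\mathbb{F}_q^2$, and $u=(u_1,u_2)$, $v=(v_1,v_2)$ are adjacent iff $u_1\neq v_1$ and $(v_2-u_2)(v_1-u_1)^{-1}\in S$. A coloring is distinguishing if the only graph automorphism mapping every color class onto itself is the identity; $\chi_D(G)$ is the minimum number of colors of a proper distinguishing coloring of $G$. *)

(* Defs.v *)
From HB Require Import structures.
From mathcomp Require Import all_boot all_order all_algebra all_fingroup.
Set Implicit Arguments. Unset Strict Implicit. Unset Printing Implicit Defensive.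
Import GRing.Theory.
Local Open Scope ring_scope.

Definition GS (q : nat) (S : {set 'F_q}) : rel ('F_q * 'F_q) :=
  fun u v => (u.1 != v.1) && ((v.2 - u.2) / (v.1 - u.1) \in S).

Definition is_aut (T : finType) (e : rel T) (s : {perm T}) : Prop :=
  forall x y, e (s x) (s y) = e x y.

Definition proper_col (T : finType) (e : rel T) (k : nat) (c : T -> 'I_k) : Prop :=
  forall x y, e x y -> c x <> c y.

Definition distinguishing (T : finType) (e : rel T) (k : nat) (c : T -> 'I_k) : Prop :=
  forall s : {perm T}, is_aut e s -> (forall x, c (s x) = c x) -> s = 1%g.

Definition chiD_eq (T : finType) (e : rel T) (k : nat) : Prop :=
  (exists c : T -> 'I_k, proper_col e c /\ distinguishing e c) /\
  (forall (m : nat) (c : T -> 'I_m), proper_col e c -> distinguishing e c -> (k <= m)%N).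

(* Main.v *)
(** The vertical lines, with the origin recoloured, give a proper distinguishing colouring with
    [q + 1] colours: a colour-preserving automorphism fixes the origin, so it is a homothety, and
    it preserves the first coordinate.

    With at most [q] colours, every colour class has exactly [q] points, because it meets each line
    with slope in [S] at most once.  Such a class [U] determines no direction of [S], and the
    Rédei–Lovász–Schrijver method shows that it is a line.  For each linear form [v], the polynomial
    [R = \prod_(u in U) ('X - v u)] has the form ['X^q + g] with [deg g <= n := (q + 1) / 2],
    since its higher coefficients, as polynomials in the slope, vanish on [S].  As [R] divides
    [('X^q - 'X) * R'], it divides [('X + g) * g'], which has degree at most [q]; solving
    [('X + g) * g' = C *: R] gives, up to translation, [g = a 'X^n] or [g = a 'X^n + 'X].  The first
    case is a line with [n] points of [U]; the second one has few coincidences.  Counting the pairs of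
    points of [U] by direction, at least two directions have a line with [n] points.  In the
    coordinates given by these two lines, the complement of [S] is invariant under a nontrivial
    diagonal map, which is an automorphism fixing the origin but not a homothety.

    Finally, [q] disjoint lines are parallel, and a translation along them preserves the
    colouring. *)
Require Import Defs.
From HB Require Import structures.
From mathcomp Require Import all_boot all_order all_algebra all_fingroup.
From mathcomp Require Import finfield.
From mathcomp Require Import zify ring.
Set Implicit Arguments. Unset Strict Implicit. Unset Printing Implicit Defensive.
Import GRing.Theory.
Local Open Scope ring_scope.

(** * The differential equation of a lacunary polynomial *)

(** Here [a *: 'X^n + r] is the lower part of a root polynomial with leading term ['X^p]. Since
    [n + n = 1] in [F], high coefficients force [r] to be linear, and the coefficients of
    ['X^(n.-1)], ['X^n] and ['X] then determine it. *)
Lemma lacunary_ode (F : fieldType) (p n : nat) (a C : F) (r : {poly F}) :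
  p \in [pchar F] -> (p.+1 = n + n)%N -> (2 < n)%N -> a != 0 ->
  (size r <= n.-1)%N ->
  ('X + (a *: 'X^n + r)) * (a *: 'X^n + r)^`() =
    C *: ('X^p + (a *: 'X^n + r)) ->
  r = 0 \/ r = 'X.
Proof.
move=> chF Ep n2 a0 sr E.
have hh : n%:R + n%:R = 1 :> F.
  by rewrite -natrD -Ep mulrSr (pcharf0 chF) add0r.
have nz k : (0 < k < p)%N -> k%:R != 0 :> F.
  move=> /andP[k0 kp]; rewrite -(dvdn_pcharf chF).
  by apply/negP => /(dvdn_leq k0); lia.
have {}E : (a * n%:R) *: ('X^(n.-1) * ('X + r)) + a *: ('X^n * r^`())
   + (a * a * n%:R) *: 'X^p + ('X + r) * r^`() =
   C *: ('X^p + (a *: 'X^n + r)).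
  rewrite -E derivD derivZ derivXn.
  have -> : 'X^p = 'X^n * 'X^(n.-1) :> {poly F} by rewrite -exprD; congr ('X^_); lia.
  by rewrite -!mul_polyC -mulr_natr !polyCM !polyC_natr; ring.
have sr2 : (size r <= 2)%N.
  (* If [deg r = k >= 2], the coefficient of [X^(n+k-1)] forces [2k + 1 = 0] in [F]. *)
  rewrite leqNgt; apply/negP => sr3.
  pose k := (size r).-1.
  have sk : size r = k.+1 by rewrite /k; lia.
  have b0 : r`_k != 0 by rewrite -[r`_k]/(lead_coef r) lead_coef_eq0 -size_poly_gt0; lia.
  have := congr1 (fun P : {poly F} => P`_(n + k).-1) E.
  have big : (('X + r) * r^`())`_(n + k).-1 = 0.
    apply: nth_default.
    apply: leq_trans (size_polyMleq _ _) _.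
    have s1 : (size ('X + r)%R <= k.+1)%N.
      by apply: leq_trans (size_polyD _ _) _; rewrite size_polyX; lia.
    have s2 : (size r^`() < k.+1)%N.
      by rewrite -sk; apply: lt_size_deriv; rewrite -size_poly_gt0; lia.
    by lia.
  rewrite !coefD !coefZ !coefD big !coefXnM !coefZ !coefXn coefD coefX coef_deriv.
  have -> : ((n + k).-1 < n.-1)%N = false by lia.
  have -> : ((n + k).-1 < n)%N = false by lia.
  have -> : ((n + k).-1 - n.-1 = k)%N by lia.
  have -> : ((n + k).-1 - n = k.-1)%N by lia.
  have -> : ((n + k).-1 == p) = false by lia.
  have -> : ((n + k).-1 == n) = false by lia.
  have -> : (k == 1)%N = false by lia.
  have -> : r`_(n + k).-1 = 0 by apply: nth_default; rewrite sk; lia.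
  have -> : k.-1.+1 = k by lia.
  rewrite -[_ *+ k]mulr_natr !(mulr0, addr0, add0r) => E1.
  have : a * r`_k * (k + k).+1%:R = 0.
    have -> : (k + k).+1%:R = k%:R + k%:R + (n%:R + n%:R) :> F.
      by rewrite hh -natrD natr1.
    by transitivity (2%:R * (a * n%:R * r`_k + a * (r`_k * k%:R)));
      [ring | rewrite E1 mulr0].
  apply/eqP; rewrite !mulf_neq0 //; apply: nz; lia.
pose b := r`_1; pose e := r`_0.
have Er : r = b *: 'X + e%:P.
  apply/polyP => -[|[|i]]; rewrite !coefE ?mulr0 ?add0r ?mulr1 ?addr0 //.
  by rewrite nth_default //; apply: leq_trans sr2 _.
have dr : r^`() = b%:P by rewrite Er derivD derivZ derivX derivC addr0 alg_polyC.
have {}E : (a * n%:R * (b + 1)) *: 'X^n + (a * n%:R * e) *: 'X^(n.-1)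
   + (a * b) *: 'X^n + (a * a * n%:R) *: 'X^p + (b * (b + 1)) *: 'X + (b * e)%:P =
   C *: 'X^p + (C * a) *: 'X^n + (C * b) *: 'X + (C * e)%:P.
  have -> : C *: 'X^p + (C * a) *: 'X^n + (C * b) *: 'X + (C * e)%:P
     = C *: ('X^p + (a *: 'X^n + r)).
    by rewrite Er -!mul_polyC !polyCM; ring.
  rewrite -E dr Er -!mul_polyC.
  have -> : 'X^n = 'X * 'X^(n.-1) :> {poly F} by rewrite -exprS; congr ('X^_); lia.
  by rewrite !polyCM !polyCD; ring.
have cf k := congr1 (fun P : {poly F} => P`_k) E.
have cn := cf n; have cn1 := cf n.-1; have c1 := cf 1%N.
rewrite !coefE !eqxx in cn cn1 c1.
have [e1 e2 e3 e4] : [/\ (p == n) = false, (p == n.-1) = false,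
  (p == 1)%N = false & (n == 1)%N = false] by split; lia.
have [f1 f2 f3 f4] : [/\ (n == n.-1) = false, (n == 0)%N = false,
  (n.-1 == 1)%N = false & (n.-1 == 0)%N = false] by split; lia.
rewrite [n.-1 == n]eq_sym [n == p]eq_sym [n.-1 == p]eq_sym [1%N == n]eq_sym
  [1%N == p]eq_sym [1%N == n.-1]eq_sym e1 e2 e3 e4 f1 f2 f3 f4
  !(mulr0, mulr1, addr0, add0r) in cn cn1 c1.
have n0 : n%:R != 0 :> F by apply: nz; lia.
have e0 : e = 0.
  by apply/eqP; move/eqP: cn1; rewrite !mulf_eq0 (negPf a0) (negPf n0) /=.
(* The coefficients of ['X^n] and ['X] say [C = n(b + 1) + b] and [b(b + 1) = C b]. If [b != 0],
   then [C = b + 1], and doubling the first equation with [2n = 1] gives [b = 1]. *)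
move: cn; rewrite -mulrA -mulrDr [C * a]mulrC => /(mulfI a0) cn.
have Eb : b = 0 \/ b = 1.
  have /eqP : b * (b + 1 - C) = 0 by rewrite mulrBr c1; ring.
  rewrite mulf_eq0 => /orP[/eqP ->|/eqP bC]; [by left|right].
  have {}bC : C = b + 1 by apply/esym/eqP; rewrite -subr_eq0 bC.
  have E2 : (n%:R + n%:R) * (b + 1) + b + b = C + C by rewrite -cn; ring.
  have -> : b = (1 * (b + 1) + b + b) - (b + b + 1) by ring.
  by rewrite -[X in X * _]hh E2 bC; ring.
by case: Eb Er => -> ->; rewrite e0; [left; rewrite scale0r addr0|right; rewrite scale1r addr0].
Qed.

(** * Root polynomials, fibers and collisions *)

(** For [v = proj (Some y)] this is the Rédei polynomial of [U] specialised at the slope [y]. *)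
Definition root_poly (F : fieldType) (T : finType) (U : {set T}) (v : T -> F) :=
  \prod_(u in U) ('X - (v u)%:P).

Definition fiber (F : fieldType) (T : finType) (U : {set T}) (v : T -> F) x :=
  #|[set u in U | v u == x]|.

Definition collisions (F : fieldType) (T : finType) (U : {set T}) (v : T -> F) :=
  #|[set w : T * T | [&& w.1 \in U, w.2 \in U, w.1 != w.2 & v w.1 == v w.2]]|.

Lemma collisionsE (F : fieldType) (T : finType) (U : {set T}) (v : T -> F) :
  collisions U v = (\sum_(u in U) (fiber U v (v u)).-1)%N.
Proof.
rewrite /collisions -sum1_card.
rewrite (partition_big fst (mem U)) /=; last by move=> w; rewrite inE => /andP[].
apply: eq_bigr => u uU.
have -> : (fiber U v (v u)).-1 = #|[set w in U | v w == v u] :\ u|.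
  by rewrite [X in X.-1](cardsD1 u) !inE uU eqxx.
rewrite sum1dep_card -[RHS](card_imset _ (f := fun w => (u, w))); last by move=> x y [].
apply: eq_card => -[x y]; rewrite !inE /=.
apply/idP/imsetP => [/andP[/and4P[xU yU xy vxy] /eqP <-]|[w]].
  by exists y => //; rewrite !inE yU eq_sym xy eq_sym.
by rewrite !inE => /and3P[wu wU vw] [-> ->]; rewrite uU wU eq_sym wu eq_sym vw eqxx.
Qed.

(** Thus [fiber U v x] is the multiplicity of the root [x], which derivatives can bound. *)
Lemma root_poly_fiber (F : fieldType) (T : finType) (U : {set T}) (v : T -> F) x :
  exists2 Q : {poly F},
    root_poly U v = ('X - x%:P) ^+ fiber U v x * Q & Q.[x] != 0.
Proof.
exists (\prod_(u in U | v u != x) ('X - (v u)%:P)).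
  rewrite /root_poly (bigID (fun u => v u == x)) /=; congr (_ * _).
  rewrite /fiber -prodr_const; apply: eq_big => [u|u /andP[_ /eqP -> //]].
  by rewrite inE.
rewrite horner_prod; apply/prodf_neq0 => u /andP[_ vx].
by rewrite hornerXsubC subr_eq0 eq_sym.
Qed.

Lemma fiber_ge2_deriv (F : fieldType) (T : finType) (U : {set T}) (v : T -> F) x :
  (1 < fiber U v x)%N -> (root_poly U v)^`().[x] = 0.
Proof.
have [Q -> _] := root_poly_fiber U v x.
case: (fiber U v x) => [|[|k]] // _.
rewrite !exprS -!mulrA; move: (_ ^+ k * Q) => M.
by rewrite !(derivM, derivXsubC, hornerD, hornerM, hornerN, hornerX, hornerC); ring.
Qed.

Lemma fiber_ge3_deriv2 (F : fieldType) (T : finType) (U : {set T}) (v : T -> F) x :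
  (2 < fiber U v x)%N -> (root_poly U v)^`()^`().[x] = 0.
Proof.
have [Q -> _] := root_poly_fiber U v x.
case: (fiber U v x) => [|[|[|k]]] // _.
rewrite !exprS -!mulrA; move: (_ ^+ k * Q) => M.
by rewrite !(derivD, derivM, derivXsubC, derivC, hornerD, hornerM, hornerN, hornerX, hornerC); ring.
Qed.

(** Differentiation lowers the multiplicity of a root by at most one, and [P] supplies the missing
    factor. It serves for [P = 'X^p - 'X]. *)
Lemma root_poly_dvd_deriv (F : fieldType) (T : finType) (U : {set T})
    (v : T -> F) (P : {poly F}) :
  (forall x, root P x) -> root_poly U v %| P * (root_poly U v)^`().
Proof.
move=> rP; rewrite /root_poly; elim/big_rec: _ => [|u R _ IH]; first exact: dvd1p.
rewrite derivM derivXsubC mul1r mulrDr dvdp_add //.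
  by rewrite dvdp_mul // dvdp_XsubCl.
by rewrite mulrCA dvdp_mul.
Qed.

Lemma size_root_poly (F : fieldType) (T : finType) (U : {set T}) (v : T -> F) :
  size (root_poly U v) = #|U|.+1.
Proof. by rewrite /root_poly -big_enum size_prod_XsubC cardE. Qed.

Lemma root_poly_lead (F : fieldType) (T : finType) (U : {set T}) (v : T -> F) :
  (root_poly U v)`_#|U| = 1.
Proof.
have := lead_coef_prod_XsubC (enum U) xpredT v.
by rewrite lead_coefE big_enum -/(root_poly U v) size_root_poly.
Qed.

Lemma root_poly_translate (F : fieldType) (T : finType) (U : {set T}) (v : T -> F) t :
  root_poly U (fun u => v u - t) = (root_poly U v) \Po ('X + t%:P).
Proof.
rewrite /root_poly rmorph_prod; apply: eq_bigr => u _ /=.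
by rewrite comp_polyB comp_polyX comp_polyC polyCB; ring.
Qed.

Lemma coef_XaddC_exp (F : fieldType) (t : F) k :
  (('X + t%:P) ^+ k)`_k = 1 /\ (('X + t%:P) ^+ k.+1)`_k = t *+ k.+1.
Proof.
elim: k => [|k [IH1 IH2]]; first by rewrite expr0 expr1 !coefE add0r.
have E : (('X + t%:P) ^+ k.+1)`_k.+1 = 1.
  rewrite exprS mulrDl coefD coefXM coefCM /= IH1 [X in t * X]nth_default ?mulr0 ?addr0 //.
  by apply: leq_trans (size_poly_exp_leq _ _) _; rewrite size_XaddC mul1n.
split=> //; rewrite exprS mulrDl coefD coefXM coefCM /= IH2 E mulr1.
by rewrite [RHS]mulrSr.
Qed.

(** * Collisions of a lacunary root polynomial *)

(** The last hypothesis is a normalization reached by translating [v]; it removes the term of degree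
    [n.-1], as [lacunary_ode] demands. *)
Lemma lacunary_collisions_normalized (F : finFieldType) (p n : nat) (T : finType)
    (U : {set T}) (v : T -> F) :
  prime p -> #|F| = p -> (p.+1 = n + n)%N -> (2 < n)%N -> #|U| = p ->
  (forall i, (n < i < p)%N -> (root_poly U v)`_i = 0) ->
  ((root_poly U v)`_n != 0 -> (root_poly U v)`_n.-1 = 0) ->
  [\/ exists t, {in U, forall u, v u = t},
      (collisions U v <= p.-1)%N
    | exists2 t, fiber U v t = n & (collisions U v <= n * n.-1)%N].
Proof.
move=> pp cF Ep n2 cU Rgap Rn.
have chF : p \in [pchar F] by apply: (@card_finPcharP _ _ 1); rewrite ?expn1.
have fermat (x : F) : x ^+ p = x by rewrite -{1}cF; exact: expf_card.
have z0 k : (0 < k)%N -> (0 : F) ^+ k = 0 by case: k => // k _; rewrite exprS mul0r.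
have [np n1p pgt0] : [/\ (0 < n)%N, (0 < n.-1)%N & (0 < p)%N] by split; lia.
set R := root_poly U v in Rgap Rn.
have sR : size R = p.+1 by rewrite size_root_poly cU.
have Rp : R`_p = 1 by rewrite /R -cU root_poly_lead.
pose g := R - 'X^p.
have ER : R = 'X^p + g by rewrite /g addrC subrK.
have gE i : i != p -> g`_i = R`_i by move=> ip; rewrite /g coefB coefXn (negPf ip) subr0.
have sg : (size g <= n.+1)%N.
  apply/leq_sizeP => j nj; have [->|jp] := eqVneq j p.
    by rewrite /g coefB Rp coefXn eqxx subrr.
  rewrite gE //; have [jlt|jgt] := ltnP j p; first by apply: Rgap; lia.
  by apply: nth_default; rewrite sR; lia.
have dR : R^`() = g^`().
  by rewrite ER derivD derivXn -mulr_natr -polyC_natr (pcharf0 chF) polyC0 mulr0 add0r.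
have rt (x : F) : root ('X^p - 'X) x.
  by rewrite rootE hornerD hornerN hornerXn hornerX fermat subrr.
have dvd : R %| ('X + g) * g^`().
  have := root_poly_dvd_deriv U v rt; rewrite -/R dR => h.
  have -> : ('X + g) * g^`() = R * g^`() - ('X^p - 'X) * g^`() by rewrite ER; ring.
  by rewrite dvdp_sub // dvdp_mulr.
(* If [g' = 0], then [g] is a constant, its degree being below [p]. By Fermat, [R] takes the value
   [x + g] at [x], so it has a single root in [F]. *)
have [g'0|g'n0] := eqVneq g^`() 0.
  apply: Or31.
  have gC : g = (g`_0)%:P.
    apply/polyP => -[|i]; rewrite coefC //=.
    have [ilt|ige] := ltnP i n; last by apply: nth_default; apply: leq_trans sg _.
    have := congr1 (fun P : {poly F} => P`_i) g'0; rewrite coef_deriv coef0 -mulr_natr.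
    move/eqP; rewrite mulf_eq0 -(dvdn_pcharf chF) => /orP[/eqP //|/dvdn_leq].
    by move=> /(_ isT); lia.
  exists (- g`_0) => u uU.
  have : root R (v u).
    by rewrite /R /root_poly (bigD1 u) //= rootM root_XsubC eqxx.
  rewrite rootE ER {1}gC hornerD hornerXn hornerC fermat addr_eq0.
  by move/eqP.
(* If [g = - 'X], then [R' = -1] and all roots are simple. *)
have [Xg0|Xgn0] := eqVneq ('X + g) 0.
  apply: Or32; rewrite collisionsE big1 // => u uU.
  have [|] := leqP (fiber U v (v u)) 1; first by case: (fiber _ _ _) => [|[]].
  move/fiber_ge2_deriv; rewrite -/R dR.
  have -> : g = - 'X by apply/eqP; rewrite -addr_eq0 addrC Xg0.
  by rewrite derivN derivX !hornerE => /eqP; rewrite oppr_eq0 oner_eq0.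
have [q Eq] := dvdpP _ _ dvd.
have q0 : q != 0.
  by apply: contraNneq (mulf_neq0 Xgn0 g'n0) => q0; rewrite Eq q0 mul0r.
have R0 : R != 0 by rewrite -size_poly_gt0 sR.
(* The product [('X + g) * g'] has degree at most [2n - 1 = p], so the nonzero quotient [q] is
   constant and [g] has degree exactly [n]. *)
have sz : (size q + p.+1 = size ('X + g)%R + size g^`())%N.
  have := congr1 (fun P : {poly F} => size P) Eq.
  rewrite !size_mul // sR => h.
  by rewrite -[RHS]prednK ?addn_gt0 ?size_poly_gt0 ?Xgn0 // h addnS.
have q1 : (0 < size q)%N by rewrite size_poly_gt0.
have gn0 : g != 0 by apply: contraNneq g'n0 => ->; rewrite deriv0.
have sg' := lt_size_deriv gn0.
have sXg : (size ('X + g)%R <= maxn 2 (size g))%N.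
  by apply: leq_trans (size_polyD _ _) _; rewrite size_polyX.
have sgE : size g = n.+1 by lia.
have a0 : g`_n != 0 by rewrite -[n]/(n.+1.-1) -sgE -lead_coefE lead_coef_eq0.
have qC : q = (q`_0)%:P by apply: size1_polyC; lia.
have Rn1 : g`_n.-1 = 0.
  by rewrite gE; [apply: Rn; rewrite -gE //|]; lia.
pose r := g - g`_n *: 'X^n.
have Eg : g = g`_n *: 'X^n + r by rewrite /r addrC subrK.
have sr : (size r <= n.-1)%N.
  apply/leq_sizeP => j nj; rewrite /r coefB coefZ coefXn.
  have [->|jn] := eqVneq j n; first by rewrite mulr1 subrr.
  rewrite mulr0 subr0; have [->//|jn1] := eqVneq j n.-1.
  by apply: nth_default; rewrite sgE; lia.
have n0 : n%:R != 0 :> F.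
  by rewrite -(dvdn_pcharf chF); apply/negP => /dvdn_leq; lia.
have n10 : n.-1%:R != 0 :> F.
  by rewrite -(dvdn_pcharf chF); apply/negP => /dvdn_leq; lia.
case: (@lacunary_ode F p n g`_n q`_0 r) => //.
- by rewrite -Eg -ER Eq {1}qC mul_polyC.
(* Now [R = 'X^n * ('X^(n.-1) + a)]: the value [0] has multiplicity [n], and [R' = n a 'X^(n.-1)]
   makes all other roots simple. *)
- move=> r0; have {}Eg : g = g`_n *: 'X^n by rewrite {1}Eg r0 addr0.
  have fn : fiber U v 0 = n.
    have [Q EQ Q0] := root_poly_fiber U v 0.
    move: EQ; rewrite -/R subr0 ER Eg.
    have -> : 'X^p + g`_n *: 'X^n = 'X^n * ('X^(n.-1) + (g`_n)%:P) :> {poly F}.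
      rewrite -mul_polyC.
      have -> : 'X^p = 'X^n * 'X^(n.-1) :> {poly F}.
        by rewrite -exprD; have -> : (n + n.-1 = p)%N by lia.
      by ring.
    set m := fiber U v 0 => EQ.
    have X0 k : 'X^k != 0 :> {poly F} by rewrite monic_neq0 ?monicXn.
    have [lt|gt|//] := ltngtP m n.
      have : 'X^m * ('X^(n - m) * ('X^(n.-1) + (g`_n)%:P)) = 'X^m * Q.
        by rewrite -EQ mulrA -exprD subnKC // ltnW.
      move/(mulfI (X0 m)) => EQ2; move: Q0; rewrite -EQ2 hornerM hornerXn.
      by rewrite z0 ?subn_gt0 // mul0r eqxx.
    have : 'X^n * ('X^(n.-1) + (g`_n)%:P) = 'X^n * ('X^(m - n) * Q).
      by rewrite EQ mulrA -exprD subnKC // ltnW.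
    move/(mulfI (X0 n)) => EQ2.
    have := congr1 (fun P : {poly F} => P.[0]) EQ2.
    rewrite hornerD !hornerM !hornerXn hornerC !z0 ?subn_gt0 // mul0r.
    by rewrite add0r => /eqP; rewrite (negPf a0).
  apply: Or33; exists 0 => //.
  rewrite collisionsE (bigID (fun u => v u == 0)) /= [X in (_ + X)%N]big1 ?addn0.
    under eq_bigr => u /andP[_ /eqP ->] do rewrite fn.
    rewrite sum_nat_const -{2}fn /fiber leq_mul2r; apply/orP; right.
    by rewrite leq_eqVlt; apply/orP; left; apply/eqP/eq_card => u; rewrite !inE.
  move=> u /andP[uU vu0].
  have [|] := leqP (fiber U v (v u)) 1; first by case: (fiber _ _ _) => [|[]].
  move/fiber_ge2_deriv; rewrite -/R dR Eg derivZ derivXn -mulr_natr -polyC_natr.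
  rewrite hornerZ hornerM hornerXn hornerC => /eqP.
  by rewrite !mulf_eq0 (negPf a0) (negPf n0) expf_eq0 (negPf vu0) andbF.
(* Now [R'(0) = 1], and [R''] vanishes only at [0]: the root [0] is simple and the others are at
   most double. The point above [0] has no collision, which saves one in the bound. *)
- move=> rX; have {}Eg : g = g`_n *: 'X^n + 'X by rewrite {1}Eg rX.
  have dg : g^`() = (g`_n * n%:R) *: 'X^(n.-1) + 1.
    by rewrite Eg derivD derivX derivZ derivXn -scaler_nat scalerA -Eg.
  have dg2 : g^`()^`() = (g`_n * n%:R * n.-1%:R) *: 'X^(n.-2).
    by rewrite dg derivD derivC addr0 derivZ derivXn -scaler_nat scalerA.
  have f0 : (fiber U v 0%R <= 1)%N.
    rewrite leqNgt; apply/negP => /fiber_ge2_deriv; rewrite -/R dR dg.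
    rewrite hornerD hornerC hornerZ hornerXn z0 //.
    by rewrite mulr0 add0r => /eqP; rewrite oner_eq0.
  have f2 x : (fiber U v x <= 2)%N.
    rewrite leqNgt; apply/negP => f3; move/fiber_ge3_deriv2: (f3); rewrite -/R dR dg2.
    rewrite hornerZ hornerXn => /eqP; rewrite !mulf_eq0 (negPf a0) (negPf n0) (negPf n10).
    by rewrite expf_eq0 /= => /andP[_ /eqP x0]; move: f3; rewrite x0 ltnNge (leq_trans f0).
  have [u0 u0U vu0] : exists2 u0, u0 \in U & v u0 = 0.
    have : root R 0.
      rewrite rootE ER Eg !hornerD hornerZ !hornerXn hornerX !z0 //.
      by rewrite mulr0 !addr0.
    rewrite rootE horner_prod => /prodf_eq0[u uU].
    by rewrite hornerXsubC sub0r oppr_eq0 => /eqP vu; exists u.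
  apply: Or32; rewrite collisionsE (bigD1 u0) //= vu0.
  have -> : (fiber U v 0).-1 = 0%N by case: (fiber U v 0) f0 => [|[]].
  rewrite add0n -cU (cardsD1 u0) u0U /= -sum1_card.
  rewrite (eq_bigl (fun u => u \in U :\ u0)); last by move=> u; rewrite !inE andbC.
  by apply: leq_sum => u _; case: (fiber U v (v u)) (f2 (v u)) => [|[|[]]].
Qed.

Lemma translate_coef (F : fieldType) (n : nat) (g : {poly F}) (t : F) :
  (0 < n)%N -> (size g <= n.+1)%N ->
  (g \Po ('X + t%:P))`_n.-1 = g`_n.-1 + g`_n * t *+ n.
Proof.
case: n => // n _ sg /=.
pose r := g - g`_n.+1 *: 'X^(n.+1) - g`_n *: 'X^n.
have sr : (size r <= n)%N.
  apply/leq_sizeP => j nj; rewrite /r !coefB !coefZ !coefXn.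
  have [->|jn] := eqVneq j n; first by rewrite ltn_eqF // mulr0 mulr1 subr0 subrr.
  have [->|jn1] := eqVneq j n.+1; first by rewrite mulr0 mulr1 subr0 subrr.
  by rewrite nth_default; [rewrite !mulr0 !subr0 | apply: leq_trans sg _; lia].
have -> : g \Po ('X + t%:P) = g`_n.+1 *: ('X + t%:P) ^+ n.+1
    + g`_n *: ('X + t%:P) ^+ n + (r \Po ('X + t%:P)).
  by rewrite /r !comp_polyB !comp_polyZ !comp_Xn_poly -!mul_polyC; ring.
have [E1 E2] := coef_XaddC_exp t n.
rewrite !coefD !coefZ E1 E2 [X in _ + X]nth_default.
  by rewrite -mulrnAr; ring.
by rewrite size_comp_poly2 ?size_XaddC.
Qed.

(** Translating the values of [v] changes neither the collisions nor the sizes of the fibers, and by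
    Frobenius it changes ['X^p] only by a constant, so the normalized case applies. *)
Lemma lacunary_collisions (F : finFieldType) (p n : nat) (T : finType)
    (U : {set T}) (v : T -> F) :
  prime p -> #|F| = p -> (p.+1 = n + n)%N -> (2 < n)%N -> #|U| = p ->
  (forall i, (n < i < p)%N -> (root_poly U v)`_i = 0) ->
  [\/ exists t, {in U, forall u, v u = t},
      (collisions U v <= p.-1)%N
    | exists2 t, fiber U v t = n & (collisions U v <= n * n.-1)%N].
Proof.
move=> pp cF Ep n2 cU Rgap.
have chF : p \in [pchar F] by apply: (@card_finPcharP _ _ 1); rewrite ?expn1.
have n0 : n%:R != 0 :> F.
  by rewrite -(dvdn_pcharf chF); apply/negP => /dvdn_leq; lia.
have [Rn0|Rn0] := eqVneq (root_poly U v)`_n 0.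
  by apply: lacunary_collisions_normalized; rewrite ?Rn0 ?eqxx.
set R := root_poly U v in Rgap Rn0.
have sR : size R = p.+1 by rewrite size_root_poly cU.
pose g := R - 'X^p.
have ER : R = 'X^p + g by rewrite /g addrC subrK.
have gE i : i != p -> g`_i = R`_i by move=> ip; rewrite /g coefB coefXn (negPf ip) subr0.
have sg : (size g <= n.+1)%N.
  apply/leq_sizeP => j nj; have [->|jp] := eqVneq j p.
    by rewrite /g coefB -{1}cU root_poly_lead coefXn eqxx subrr.
  rewrite gE //; have [jlt|jgt] := ltnP j p; first by apply: Rgap; lia.
  by apply: nth_default; rewrite sR; lia.
(* By [translate_coef], this shift kills the coefficient of ['X^(n.-1)]. *)
pose t := - g`_n.-1 / (g`_n * n%:R).
have gn0 : g`_n != 0 by rewrite gE //; lia.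
have Rt : root_poly U (fun u => v u - t) = 'X^p + (t ^+ p)%:P + (g \Po ('X + t%:P)).
  rewrite root_poly_translate -/R ER comp_polyD comp_Xn_poly; congr (_ + _).
  rewrite exprDn_pchar ?rmorphXn //.
  by rewrite pnatE // pchar_poly.
have fib x : fiber U (fun u => v u - t) x = fiber U v (x + t).
  by apply: eq_card => u; rewrite !inE subr_eq.
have col : collisions U (fun u => v u - t) = collisions U v.
  by apply: eq_card => u; rewrite !inE (inj_eq (addIr _)).
have sgt : size (g \Po ('X + t%:P)) = size g by rewrite size_comp_poly2 ?size_XaddC.
case: (@lacunary_collisions_normalized F p n T U (fun u => v u - t)) => //.
- move=> i /andP[ni ip]; rewrite Rt !coefD coefXn coefC [X in _ + X]nth_default.
    have -> : (i == p) = false by lia.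
    have -> : (i == 0)%N = false by lia.
    by rewrite !addr0.
  by rewrite sgt; apply: leq_trans sg _.
- move=> _; rewrite Rt !coefD coefXn coefC translate_coef //; last by lia.
  have -> : (n.-1 == p) = false by lia.
  have -> : (n.-1 == 0)%N = false by lia.
  by rewrite mulr0n !add0r /t -[_ *+ n]mulr_natr; field; rewrite ?gn0 ?n0.
- by case=> s vs; apply: Or31; exists (s + t) => u /vs <-; rewrite subrK.
- by rewrite col => ?; apply: Or32.
by case=> s; rewrite fib col => fs cl; apply: Or33; exists (s + t).
Qed.

(** * Directions and the Rédei polynomial *)

(* The second variable of [{poly {poly F}}] is the slope: the coefficient of [X^i] has degree at
   most [size r - i] in it, and its leading part is the product for the vertical direction. *)
Lemma bivariate_prod_coef (F : fieldType) (I : Type) (r : seq I) (a b : I -> F) i j :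
  let A := \prod_(u <- r) ('X - ((a u)%:P + b u *: 'X)%:P) : {poly {poly F}} in
  ((size r < i + j)%N -> A`_i`_j = 0) /\
  ((size r = i + j)%N -> A`_i`_j = (\prod_(u <- r) ('X - (b u)%:P))`_i).
Proof.
rewrite /=; elim: r i j => [|u r IH] i j.
  rewrite !big_nil !coef1 /=; case: i => [|i] /=; last by rewrite coef0.
  by rewrite coef1 add0n; case: j.
rewrite !big_cons.
set A := (\prod_(_ <- _) _ : {poly {poly F}}) in IH *.
set B := \prod_(_ <- r) _ in IH *.
have AE : (('X - ((a u)%:P + b u *: 'X)%:P) * A)`_i`_j =
    (if i is k.+1 then A`_k`_j else 0) - a u * A`_i`_j
    - b u * (if j is k.+1 then A`_i`_k else 0).
  rewrite mulrBl coefB coefXM coefCM coefB mulrDl -scalerAl coefD coefCM coefZ coefXM.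
  by case: i j => [|i] [|j] /=; rewrite ?coef0; ring.
have BE : (('X - (b u)%:P) * B)`_i = (if i is k.+1 then B`_k else 0) - b u * B`_i.
  by rewrite mulrBl coefB coefXM coefCM; case: i {AE} => [|i] /=.
rewrite AE BE /=; split=> ij.
  case: i j ij {AE BE} => [|i] [|j] ij;
    rewrite ?(proj1 (IH _ _)) ?mulr0 ?subr0 ?addr0 //; lia.
(* For [j = 0] the recursion reaches the coefficient of [B] just above its degree. *)
have Bs : B`_(size r).+1 = 0.
  by apply: nth_default; rewrite /B size_prod_XsubC.
case: i j ij {AE BE} => [|i] [|j] ij.
- by lia.
- rewrite (proj1 (IH _ _)); last by lia.
  rewrite (proj2 (IH _ _)); last by lia.
  by ring.
- rewrite (proj2 (IH _ _)); last by lia.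
  rewrite (proj1 (IH _ _)); last by lia.
  have -> : i.+1 = (size r).+1 by lia.
  by rewrite Bs; ring.
- rewrite (proj2 (IH i _)); last by lia.
  rewrite (proj1 (IH _ j.+1)); last by lia.
  rewrite (proj2 (IH _ j)); last by lia.
  by ring.
Qed.

(* Directions are slopes, with [None] the vertical one: [proj d] is a linear form whose level
   sets are the lines with direction [d].  The sign at [None] makes it the leading coefficient
   in [y] of [proj (Some y)]. *)
Definition proj (F : fieldType) (d : option F) (u : F * F) : F :=
  if d is Some y then u.2 - y * u.1 else - u.1.

Definition dir (F : fieldType) (u v : F * F) : option F :=
  if u.1 == v.1 then None else Some ((v.2 - u.2) / (v.1 - u.1)).

Lemma projE (F : fieldType) (d : option F) (u v : F * F) :
  u != v -> (proj d u == proj d v) = (d == dir u v).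
Proof.
case: u v => [u1 u2] [v1 v2]; rewrite /proj /dir /= => uv.
have [e|ne] := eqVneq u1 v1.
  case: d => [y|]; last by rewrite e !eqxx.
  rewrite e (inj_eq (addIr _)).
  by apply/negbTE; apply: contraNneq uv => ->; rewrite e.
case: d => [y|]; last by rewrite eqr_opp (negPf ne).
have ne' : v1 - u1 != 0 by rewrite subr_eq0 eq_sym.
rewrite (inj_eq Some_inj) -[RHS](inj_eq (mulIf ne')) divfK //.
by rewrite -[LHS]subr_eq0 -[RHS]subr_eq0; congr (_ == 0); ring.
Qed.

Lemma proj_pair_inj (F : fieldType) (d1 d2 : option F) u v :
  d1 != d2 -> proj d1 u = proj d1 v -> proj d2 u = proj d2 v -> u = v.
Proof.
move=> d12 /eqP e1 /eqP e2; apply/eqP/negPn/negP => uv.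
by move: e1 e2; rewrite !projE // => /eqP e1 /eqP e2; rewrite e1 e2 eqxx in d12.
Qed.

Lemma root_poly_inj (F : finFieldType) (T : finType) (U : {set T}) (v : T -> F) :
  #|U| = #|F| -> {in U &, injective v} -> root_poly U v = 'X^#|F| - 'X.
Proof.
move=> cU vI; rewrite finField_genPoly /root_poly.
rewrite -(big_imset (fun x => 'X - x%:P) vI) /=.
apply: eq_bigl => x; suff -> : v @: U = [set: F] by rewrite inE.
by apply/eqP; rewrite eqEcard subsetT cardsT card_in_imset // cU leqnn.
Qed.

(** For [i > n], the coefficient of ['X^i] is a polynomial in the slope of degree at most
    [p - i <= n - 2]. It vanishes at the [n - 1] slopes of [S], where the root polynomial is
    ['X^p - 'X], hence identically; its leading part covers the vertical direction. *)
Lemma root_poly_proj_gap (F : finFieldType) (p n : nat) (U : {set F * F}) (S : {set F}) :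
  #|F| = p -> (p.+1 = n + n)%N -> (0 < n)%N -> #|U| = p -> #|S| = n.-1 ->
  (forall s, s \in S -> {in U &, injective (proj (Some s))}) ->
  forall d i, (n < i < p)%N -> (root_poly U (proj d))`_i = 0.
Proof.
move=> cF Ep n0 cU cS SI d i ip.
pose A := \prod_(u <- enum U) ('X - ((u.2)%:P + (- u.1) *: 'X)%:P) : {poly {poly F}}.
have szU : size (enum U) = p by rewrite -cU cardE.
have AE (y : F) k : (A`_k).[y] = (root_poly U (proj (Some y)))`_k.
  rewrite -[LHS]/(horner_eval y A`_k) -coef_map /A rmorph_prod /root_poly -big_enum /=.
  congr ((polyseq _)`_k); apply: eq_bigr => u _.
  rewrite rmorphB /= map_polyX map_polyC /=; congr (_ - _%:P).
  by rewrite /horner_eval !hornerE; ring.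
have A0 : A`_i = 0.
  apply: (@roots_geq_poly_eq0 _ _ (enum S)).
  - apply/allP => s; rewrite mem_enum => sS; rewrite rootE AE.
    rewrite root_poly_inj ?cU //; last exact: SI.
    rewrite coefB coefXn coefX cF.
    have -> : (i == p) = false by lia.
    have -> : (i == 1)%N = false by lia.
    by rewrite subr0.
  - exact: enum_uniq.
  - rewrite -cardE cS; apply/leq_sizeP => j nj.
    by apply: (proj1 (bivariate_prod_coef _ _ _ _ _)); rewrite szU; lia.
case: d => [y|]; first by rewrite -AE A0 horner0.
have [_] := bivariate_prod_coef (enum U) snd (fun u => - u.1) i (p - i).
rewrite szU -/A A0 coef0 /root_poly -big_enum /= => <- //.
by lia.
Qed.

(** Each ordered pair of distinct points collides in exactly one direction. *)
Lemma sum_collisions_proj (F : finFieldType) (U : {set F * F}) :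
  (\sum_(d : option F) collisions U (proj d) = #|U| * #|U|.-1)%N.
Proof.
have -> : (#|U| * #|U|.-1)%N = collisions U (fun=> 0 : F).
  rewrite collisionsE -sum_nat_const; apply: eq_bigr => u _; congr _.-1.
  by apply: eq_card => w; rewrite !inE eqxx andbT.
rewrite /collisions; under eq_bigr => d _ do rewrite -sum1_card.
rewrite -[RHS]sum1_card.
rewrite (exchange_big_dep
  [pred w | w \in [set w | [&& w.1 \in U, w.2 \in U, w.1 != w.2 & 0 == 0 :> F]]]) /=.
  apply: eq_bigr => -[u v]; rewrite !inE /= eqxx andbT => /and3P[uU vU uv].
  rewrite (big_pred1 (dir u v)) // => d.
  by rewrite inE /= uU vU uv /= projE.
by move=> d w _; rewrite !inE eqxx => /and4P[-> -> ->].
Qed.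

(** * Two directions with long lines *)

(** Only the [n + 1] directions outside [S] have collisions: at most [p - 1 = 2(n - 1)] each, with
    [(n - 1)(n - 2)] more if there is a line with [n] points. With at most one such direction the
    total is at most [3n(n - 1)], less than [p(p - 1) = (4n - 2)(n - 1)], as [n > 2]. *)
Lemma two_long_directions (F : finFieldType) (p n : nat) (U : {set F * F}) (S : {set F}) :
  prime p -> #|F| = p -> (p.+1 = n + n)%N -> (2 < n)%N -> #|U| = p -> #|S| = n.-1 ->
  (forall s, s \in S -> {in U &, injective (proj (Some s))}) ->
  (forall d t, ~ {in U, forall u, proj d u = t}) ->
  exists d1 d2 t1 t2, [/\ d1 != d2, fiber U (proj d1) t1 = n & fiber U (proj d2) t2 = n].
Proof.
move=> pp cF Ep n2 cU cS SI noline.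
have n0 : (0 < n)%N by lia.
have gap := root_poly_proj_gap cF Ep n0 cU cS SI.
pose Lg := [set d : option F | [exists t, fiber U (proj d) t == n]].
pose N := ~: (Some @: S).
have cN : #|N| = n.+1.
  by have := cardsC (Some @: S); rewrite -/N card_option cF card_imset ?cS //; [lia | exact: Some_inj].
suff : (1 < #|Lg|)%N.
  case/card_gt1P => d1 [d2 [+ + d12]]; rewrite !inE => /existsP[t1 /eqP f1] /existsP[t2 /eqP f2].
  by exists d1, d2, t1, t2.
rewrite ltnNge; apply/negP => Lg1.
have bound d : (collisions U (proj d) <= (d \in N) * (n.-1 * 2) + (d \in Lg) * (n.-1 * n.-2))%N.
  have [dN|] := boolP (d \in N); last first.
    rewrite inE negbK => /imsetP[s sS ->].
    rewrite [collisions _ _](_ : _ = 0%N) //; apply/eqP; rewrite cards_eq0.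
    apply/eqP/setP => -[u v]; rewrite !inE /=; apply/negP => /and4P[uU vU uv /eqP e].
    by rewrite (SI _ sS _ _ uU vU e) eqxx in uv.
  case: (@lacunary_collisions F p n _ U (proj d)) => //; first exact: gap.
  - by case=> t /noline.
  - by move=> h; apply: leq_trans h _; rewrite mul1n; apply: leq_trans (leq_addr _ _); lia.
  case=> t ft h; have -> : d \in Lg by rewrite inE; apply/existsP; exists t; rewrite ft.
  apply: leq_trans h _; rewrite !mul1n -mulnDr mulnC leq_mul2l; apply/orP; right; lia.
have : (#|U| * #|U|.-1 <= n.+1 * (n.-1 * 2) + 1 * (n.-1 * n.-2))%N.
  rewrite -sum_collisions_proj; 
  apply: (@leq_trans (\sum_(d : option F)
    ((d \in N) * (n.-1 * 2) + (d \in Lg) * (n.-1 * n.-2)))); first exact: leq_sum.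
  rewrite big_split /= -!big_distrl /= leq_add // leq_mul2r; apply/orP; right.
    by rewrite -cN -sum1_card [leqRHS]big_mkcond /=; apply: leq_sum => d _; case: (d \in N).
  by apply: leq_trans Lg1; rewrite -sum1_card [leqRHS]big_mkcond /=; apply: leq_sum => d _; case: (d \in Lg).
rewrite cU; have -> : p = (n + n.-1)%N by lia.
case: n n2 {Ep n0 gap cN bound Lg Lg1 cS} => [|[|[|n]]] // _ /=; nia.
Qed.

(** * The diagonal symmetry *)

(** Forms of two distinct directions are coordinates of the plane, so the hypotheses say that
    [x' - y'] is [c] times [x - y]. *)
Lemma proj_parallel (F : fieldType) (d1 d2 : option F) (x y x' y' : F * F) (c : F) :
  d1 != d2 ->
  proj d1 x' - proj d1 y' = c * (proj d1 x - proj d1 y) ->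
  proj d2 x' - proj d2 y' = c * (proj d2 x - proj d2 y) ->
  forall d, proj d x' - proj d y' = c * (proj d x - proj d y).
Proof.
move=> d12 e1 e2.
pose w := (y'.1 + c * (x.1 - y.1), y'.2 + c * (x.2 - y.2)).
have wE d : proj d w = proj d y' + c * (proj d x - proj d y).
  by case: d => [z|]; rewrite /proj /w /=; ring.
have -> : x' = w.
  by apply: (proj_pair_inj d12); rewrite wE -?e1 -?e2 addrC subrK.
by move=> d; rewrite wE addrC addKr.
Qed.

(** The long lines meet in a point of [U]. Joining one further point of the first line to the
    [n - 1] further points of the second already gives all directions outside [S] other than [d1]
    and [d2]. Two choices on the first line give the same set of slopes up to a factor [h], so
    multiplication by [h] preserves that set. *)
Lemma two_long_directions_symmetry (F : finFieldType) (p n : nat) (U : {set F * F})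
    (S : {set F}) (d1 d2 : option F) (t1 t2 : F) :
  #|F| = p -> (p.+1 = n + n)%N -> (2 < n)%N -> #|U| = p -> #|S| = n.-1 ->
  (forall s, s \in S -> {in U &, injective (proj (Some s))}) ->
  d1 != d2 -> fiber U (proj d1) t1 = n -> fiber U (proj d2) t2 = n ->
  exists (h : F) (f : {perm F * F}), [/\ h != 1,
    forall x, proj d1 (f x) = proj d1 x, forall x, proj d2 (f x) = h * proj d2 x
    & forall x y, x != y -> (dir (f x) (f y) \in Some @: S) = (dir x y \in Some @: S)].
Proof.
move=> cF Ep n2 cU cS SI d12 f1 f2.
pose N := ~: (Some @: S).
have cN : #|N| = n.+1.
  by have := cardsC (Some @: S); rewrite -/N card_option cF card_imset ?cS //; [lia | exact: Some_inj].
have dirN u v : u \in U -> v \in U -> u != v -> dir u v \in N.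
  move=> uU vU uv; rewrite inE; apply/negP => /imsetP[s sS /esym/eqP].
  by rewrite -projE // => /eqP /(SI _ sS _ _ uU vU) e; rewrite e eqxx in uv.
pose psi (u : F * F) := (proj d1 u, proj d2 u).
have psiI : injective psi by move=> u v [e1 e2]; apply: proj_pair_inj e1 e2.
pose inv a b := invF psiI (a, b).
have inv1 a b : proj d1 (inv a b) = a by have [] : psi (inv a b) = (a, b) by exact: f_invF.
have inv2 a b : proj d2 (inv a b) = b by have [] : psi (inv a b) = (a, b) by exact: f_invF.
pose w0 := inv 0 0.
(* In the coordinates [(proj d1, proj d2)], [del z] is the direction of slope [z]; only [d1] is not
   of this form. *)
pose del z := dir (inv 1 z) w0.
have w1n0 z : inv 1 z != w0.
  by apply/eqP => /(congr1 (proj d1)); rewrite !inv1 => /eqP; rewrite oner_eq0.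
have delP z : proj (del z) (inv 1 z) = proj (del z) w0.
  by apply/eqP; rewrite projE.
have deln1 z : del z != d1.
  by apply/eqP => e; move: (delP z); rewrite e !inv1 => /eqP; rewrite oner_eq0.
have delI : injective del.
  move=> z z' e; apply/eqP/negPn/negP => zz.
  have ww : inv 1 z != inv 1 z' by apply: contra_neq zz => /(congr1 (proj d2)); rewrite !inv2.
  have /eqP E1 : proj d1 (inv 1 z) == proj d1 (inv 1 z') by rewrite !inv1.
  have : proj (del z) (inv 1 z) == proj (del z) (inv 1 z') by rewrite delP e delP.
  move/eqP: E1; rewrite !projE // => /eqP e1 /eqP e2.
  by have := deln1 z; rewrite e2 -e1 eqxx.
have dirE x y : proj d1 x != proj d1 y ->
    dir x y = del ((proj d2 x - proj d2 y) / (proj d1 x - proj d1 y)).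
  move=> xy1; set z := _ / _.
  have xy : x != y by apply: contra_neq xy1 => ->.
  apply/esym/eqP; rewrite -projE // -subr_eq0.
  have xy1' : proj d1 x - proj d1 y != 0 by rewrite subr_eq0.
  rewrite (@proj_parallel F d1 d2 (inv 1 z) w0 x y (proj d1 x - proj d1 y)) //.
  - by rewrite delP subrr mulr0.
  - by rewrite !inv1; ring.
  - by rewrite !inv2 /z; field.
pose A1 := [set u in U | proj d1 u == t1].
pose A2 := [set u in U | proj d2 u == t2].
have [o oA1 oA2] : exists2 o, o \in A1 & o \in A2.
  (* Two sets of [n] points in a set of [p = 2n - 1] points must meet. *)
  have /card_gt0P[o] : (0 < #|A1 :&: A2|)%N.
    have := cardsUI A1 A2; rewrite [#|A1|]f1 [#|A2|]f2.
    have : (#|A1 :|: A2| <= #|U|)%N.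
      by apply/subset_leq_card/subsetP => u; rewrite !inE => /orP[] /andP[].
    by rewrite cU; lia.
  by rewrite inE => /andP[]; exists o.
have [oU o1 o2] : [/\ o \in U, proj d1 o = t1 & proj d2 o = t2].
  by move: oA1 oA2; rewrite !inE => /andP[-> /eqP ->] /andP[_ /eqP ->].
pose B1 := A1 :\ o; pose B2 := A2 :\ o.
have cB1 : #|B1| = n.-1 by have := cardsD1 o A1; rewrite oA1 [#|A1|]f1 -/B1; lia.
have cB2 : #|B2| = n.-1 by have := cardsD1 o A2; rewrite oA2 [#|A2|]f2 -/B2; lia.
have B1P u : u \in B1 -> [/\ u \in U, proj d1 u = t1, proj d2 u != t2 & u != o].
  rewrite !inE => /and3P[uo uU /eqP u1]; split=> //.
  by apply: contra_neq uo => u2; apply: (proj_pair_inj d12); rewrite ?o1 ?o2.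
have B2P u : u \in B2 -> [/\ u \in U, proj d2 u = t2, proj d1 u != t1 & u != o].
  rewrite !inE => /and3P[uo uU /eqP u1]; split=> //.
  by apply: contra_neq uo => u2; apply: (proj_pair_inj d12); rewrite ?o1 ?o2.
have [u0 [u1 [u0B u1B u01]]] : exists u v, [/\ u \in B1, v \in B1 & u != v].
  by apply/card_gt1P; rewrite cB1; lia.
have [v0 v0B] : exists v, v \in B2 by apply/card_gt0P; rewrite cB2; lia.
have d1N : d1 \in N.
  have [uU u1t _ uo] := B1P _ u0B.
  suff -> : d1 = dir u0 o by apply: dirN.
  by apply/eqP; rewrite -projE // u1t o1.
have d2N : d2 \in N.
  have [uU u1t _ uo] := B2P _ v0B.
  suff -> : d2 = dir v0 o by apply: dirN.
  by apply/eqP; rewrite -projE // u1t o2.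
have del0 : del 0 = d2 by apply/esym/eqP; rewrite -projE // !inv2.
pose Z := [set z | (z != 0) && (del z \in N)].
have cZ : (#|Z| <= n.-1)%N.
  rewrite -(card_imset _ delI).
  have -> : n.-1 = #|N :\ d1 :\ d2|.
    have := cardsD1 d1 N; have := cardsD1 d2 (N :\ d1).
    by rewrite cN d1N !inE eq_sym d12 -/N; move: d2N; rewrite inE => -> /=; lia.
  apply/subset_leq_card/subsetP => d /imsetP[z]; rewrite inE => /andP[z0 zN] ->.
  by rewrite in_setD1 in_setD1 zN deln1 andbT andbT -del0 (inj_eq delI).
pose X := [set proj d1 v - t1 | v in B2].
(* Each [u \in B1] already accounts for all of [Z], so rescaling from one [u] to another
   preserves [Z]. *)
have ZE u : u \in B1 -> Z = [set - (proj d2 u - t2) / x | x in X].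
  move=> uB; have [uU u1t u2t uo] := B1P _ uB.
  have u2t' : proj d2 u - t2 != 0 by rewrite subr_eq0.
  apply/esym/eqP; rewrite eqEcard; apply/andP; split.
    apply/subsetP => z /imsetP[x /imsetP[v vB ->] ->].
    have [vU v2t v1t vo] := B2P _ vB.
    have v1t' : proj d1 v - t1 != 0 by rewrite subr_eq0.
    rewrite inE mulf_neq0 ?oppr_eq0 ?invr_eq0 //=.
    have uv1 : proj d1 u != proj d1 v by rewrite u1t eq_sym.
    have uv : u != v by apply: contra_neq uv1 => ->.
    have := dirN _ _ uU vU uv; rewrite dirE // u1t v2t.
    by rewrite -[t1 - _]opprB invrN mulrN mulNr.
  rewrite card_imset; last first.
    by move=> x y /(mulfI _) e; apply/invr_inj/e; rewrite oppr_eq0.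
  rewrite card_in_imset ?cB2 // => v v' vB v'B /addIr e.
  have [_ e2 _ _] := B2P _ vB; have [_ e2' _ _] := B2P _ v'B.
  by apply: (proj_pair_inj d12); rewrite // e2 e2'.
have [_ u0t u0t' _] := B1P _ u0B; have [_ u1t u1t' _] := B1P _ u1B.
pose y0 := proj d2 u0 - t2; pose y1 := proj d2 u1 - t2.
have y00 : y0 != 0 by rewrite subr_eq0.
have y10 : y1 != 0 by rewrite subr_eq0.
pose h := y1 / y0.
have h0 : h != 0 by rewrite mulf_neq0 // invr_eq0.
have ZhS z : z \in Z -> h * z \in Z.
  rewrite {1}(ZE _ u0B) (ZE _ u1B) => /imsetP[x xX ->]; apply/imsetP; exists x => //.
  have x0 : x != 0 by move: xX => /imsetP[v /B2P[_ _ v1 _] ->]; rewrite subr_eq0.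
  by rewrite -/y0 -/y1 /h; field; rewrite ?x0 ?y00.
have hZ z : (h * z \in Z) = (z \in Z).
  (* An injective map of the finite set [Z] into itself is onto, which gives the converse of
     [ZhS]. *)
  have hI : injective ( *%R h) by apply: mulfI.
  have imZ : ( *%R h) @: Z = Z.
    apply/eqP; rewrite eqEcard card_imset // leqnn andbT.
    by apply/subsetP => _ /imsetP[x /ZhS ? ->].
  by rewrite -{1}imZ (mem_imset _ _ hI).
have hdel z : (del (h * z) \in N) = (del z \in N).
  have [->|z0] := eqVneq z 0; first by rewrite mulr0.
  by have := hZ z; rewrite ![_ \in Z]inE mulf_neq0 // z0.
have fI : injective (fun x => inv (proj d1 x) (h * proj d2 x)).
  move=> x y e; apply: (proj_pair_inj d12).
    by have := congr1 (proj d1) e; rewrite !inv1.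
  by have := congr1 (proj d2) e; rewrite !inv2 => /(mulfI h0).
exists h, (perm fI); split.
- apply: contra_neq u01 => h1; apply: (proj_pair_inj d12); first by rewrite u0t u1t.
  have : y1 = y0 by rewrite -[y1](divfK y00) -/h h1 mul1r.
  by move/addIr => ->.
- by move=> x; rewrite permE inv1.
- by move=> x; rewrite permE inv2.
move=> x y xy; apply: negb_inj; rewrite -!in_setC -/N !permE.
(* Pairs of direction [d1] keep it; for all others the slope is multiplied by [h]. *)
have [e|ne] := eqVneq (proj d1 x) (proj d1 y).
  have fxy : inv (proj d1 x) (h * proj d2 x) != inv (proj d1 y) (h * proj d2 y).
    by rewrite (inj_eq fI).
  have <- : d1 = dir x y by apply/eqP; rewrite -projE // e.
  suff <- : d1 = dir (inv (proj d1 x) (h * proj d2 x)) (inv (proj d1 y) (h * proj d2 y)) by [].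
  by apply/eqP; rewrite -projE // !inv1 e.
rewrite dirE ?inv1 // [dir x y]dirE // !inv2 -mulrBr -mulrA; exact: hdel.
Qed.

(** * Independent sets of the graph *)

Lemma GS_dir (q : nat) (S : {set 'F_q}) x y :
  x != y -> GS S x y = (dir x y \in Some @: S).
Proof.
rewrite /GS /dir => xy; case: eqVneq => [_|_] /=.
  by apply/esym/negbTE/imsetP => -[].
by rewrite (mem_imset _ _ Some_inj).
Qed.

Lemma GSxx (q : nat) (S : {set 'F_q}) x : GS S x x = false.
Proof. by rewrite /GS eqxx. Qed.

Lemma independent_proj_inj (q : nat) (S : {set 'F_q}) (U : {set 'F_q * 'F_q}) :
  {in U &, forall x y, ~~ GS S x y} ->
  forall s, s \in S -> {in U &, injective (proj (Some s))}.
Proof.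
move=> ind s sS x y xU yU e; apply/eqP/negPn/negP => xy.
have := ind x y xU yU; rewrite GS_dir //; move/eqP: e; rewrite projE // => /eqP <-.
by rewrite (mem_imset _ _ Some_inj) sS.
Qed.

(** If [S = [set s]], the graph is a disjoint union of cliques, the lines of slope [s]. The shear
    [f] moves each line along itself and fixes the origin, but sends [(0, 1)] to [(1, 1 + s)], so it
    is not a homothety. *)
Lemma card_slopes_neq1 (q : nat) (S : {set 'F_q}) :
  prime q ->
  (forall s : {perm 'F_q * 'F_q}, is_aut (GS S) s /\ s (0, 0) = (0, 0) ->
      exists2 l : 'F_q, l != 0 & forall v, s v = (l * v.1, l * v.2)) ->
  #|S| != 1%N.
Proof.
move=> pq stab; apply/negP => /cards1P[s ES].
pose m (x : 'F_q * 'F_q) := x.2 - s * x.1.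
pose f (x : 'F_q * 'F_q) := (x.1 + m x, x.2 + s * m x).
have mf x : m (f x) = m x by rewrite /m /f /=; ring.
have fI : injective f.
  move=> x y e; have em : m x = m y by rewrite -mf e mf.
  have := congr1 fst e; have := congr1 snd e; rewrite /f /= em => /addIr e2 /addIr e1.
  by rewrite [x]surjective_pairing e1 e2 -surjective_pairing.
have GSE x y : GS S x y = (x != y) && (m x == m y).
  have [->|xy] := eqVneq x y; first by rewrite GSxx.
  rewrite GS_dir // -[m x]/(proj (Some s) x) -[m y]/(proj (Some s) y) projE // ES.
  by rewrite imset_set1 in_set1 eq_sym.
have [|l _ lE] := stab (perm fI).
  split=> [x y|]; first by rewrite !permE !GSE !mf (inj_eq fI).
  by rewrite permE /f /m /=; congr (_, _); ring.
have /(congr1 fst) := lE (0, 1); rewrite permE /f /m /= => /eqP.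
by rewrite !mulr0 subr0 add0r oner_eq0.
Qed.

Lemma independent_set_is_line (q : nat) (S : {set 'F_q}) (U : {set 'F_q * 'F_q}) :
  prime q -> (3 < q)%N -> #|S| = (q.-1)./2 ->
  (forall s : {perm 'F_q * 'F_q}, is_aut (GS S) s /\ s (0, 0) = (0, 0) ->
      exists2 l : 'F_q, l != 0 & forall v, s v = (l * v.1, l * v.2)) ->
  #|U| = q -> {in U &, forall x y, ~~ GS S x y} ->
  exists d t, {in U, forall u, proj d u = t}.
Proof.
move=> pq q3 cS stab cU ind.
have [/existsP[d /existsP[t /forall_inP h]]|nl] :=
    boolP [exists d, exists t, [forall u in U, proj d u == t]].
  by exists d, t => u /h /eqP.
have qodd : odd q by have [e|] := even_prime pq; [rewrite e in q3|].
pose n := (q.+1)./2.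
have Ep : (q.+1 = n + n)%N by rewrite addnn /n -[LHS]odd_double_half /= qodd.
have n2 : (2 < n)%N by lia.
have cSn : #|S| = n.-1 by rewrite cS; lia.
have SI := independent_proj_inj ind.
have [d1 [d2 [t1 [t2 [d12 f1 f2]]]]] :
  exists d1 d2 t1 t2, [/\ d1 != d2, fiber U (proj d1) t1 = n & fiber U (proj d2) t2 = n].
  apply: (two_long_directions pq (card_Fp pq) Ep n2 cU cSn SI) => d t h.
  case/existsP: nl; exists d; apply/existsP; exists t; apply/forall_inP => u uU.
  by rewrite h.
have [h [f [h1 fd1 fd2 fS]]] :=
  two_long_directions_symmetry (card_Fp pq) Ep n2 cU cSn SI d12 f1 f2.
exfalso.
have proj0 d : proj d (0, 0) = 0 :> 'F_q by case: d => [y|]; rewrite /proj /=; ring.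
have [|l _ lE] := stab f.
  split=> [x y|]; last by apply: (proj_pair_inj d12); rewrite ?fd1 ?fd2 !proj0 ?mulr0.
  have [->|xy] := eqVneq x y; first by rewrite !GSxx.
  by rewrite !GS_dir ?fS // (inj_eq perm_inj).
have projf d x : proj d (f x) = l * proj d x.
  by rewrite lE; case: d => [y|]; rewrite /proj /=; ring.
have nz d : exists x : 'F_q * 'F_q, proj d x != 0.
  case: d => [y|]; first by exists (0, 1); rewrite /proj /= mulr0 subr0 oner_eq0.
  by exists (1, 0); rewrite /proj /= oppr_eq0 oner_eq0.
(* A homothety of ratio [l] would give [l = h] on [proj d2] and [l = 1] on [proj d1]. *)
have [x x2] := nz d2; have [y y1] := nz d1.
case/eqP: h1; apply: (mulIf x2); rewrite -fd2 projf; congr (_ * _).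
by apply: (mulIf y1); rewrite -projf fd1 mul1r.
Qed.

Lemma aut_translate (q : nat) (S : {set 'F_q}) (w : 'F_q * 'F_q) :
  exists2 s : {perm 'F_q * 'F_q}, is_aut (GS S) s &
    forall x, s x = (x.1 + w.1, x.2 + w.2).
Proof.
have fI : injective (fun x : 'F_q * 'F_q => (x.1 + w.1, x.2 + w.2)).
  move=> x y e; have /= /addIr e1 := congr1 fst e; have /= /addIr e2 := congr1 snd e.
  by rewrite [x]surjective_pairing e1 e2 -surjective_pairing.
exists (perm fI) => [x y|x]; rewrite !permE //.
by rewrite /GS /= (inj_eq (addIr _)); do ?congr (_ && _); congr (_ / _ \in S); ring.
Qed.

(** * The distinguishing chromatic number *)

Theorem mainTheorem11 (q : nat) (S : {set 'F_q}) :
  prime q -> (3 <= q)%N -> #|S| = (q.-1)./2 ->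
  (forall s : {perm 'F_q * 'F_q},
      (is_aut (GS S) s /\ s (0, 0) = (0, 0)) <->
      (exists2 l : 'F_q, l != 0 & forall v, s v = (l * v.1, l * v.2))) ->
  chiD_eq (GS S) q.+1.
Proof.
move=> pq q3 cS stab.
have stab' s := proj1 (stab s).
have cF := card_Fp pq.
split.
  pose col (x : 'F_q * 'F_q) : 'I_q.+1 := if x == (0, 0) then ord_max else inord x.1.
  have lt1 (x : 'F_q) : (x < q)%N by rewrite -[X in (_ < X)%N](Fp_cast pq).
  have colE x : x != (0, 0) -> col x = x.1 :> nat.
    by move=> x0; rewrite /col (negPf x0) inordK // ltnS ltnW.
  have col0 : col (0, 0) = q :> nat by rewrite /col eqxx.
  have colI x y : col x = col y -> x.1 = y.1 /\ (x == (0, 0)) = (y == (0, 0)).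
    move/(congr1 val) => /=.
    have [->|x0] := eqVneq x (0, 0); have [->|y0] := eqVneq y (0, 0) => //.
    - by rewrite col0 colE // => e; have := lt1 y.1; rewrite -e ltnn.
    - by rewrite col0 colE // => e; have := lt1 x.1; rewrite e ltnn.
    - by rewrite !colE // => /val_inj.
  exists col; split.
    by move=> x y; rewrite /GS => /andP[xy _] /colI[e _]; rewrite e eqxx in xy.
  move=> s sA sc.
  have s0 : s (0, 0) = (0, 0).
    by have [_] := colI _ _ (sc (0, 0)); rewrite eqxx => /eqP.
  have [l _ lE] := stab' s (conj sA s0).
  (* The colour of [(1, 0)] records its first coordinate, which the homothety turns into [l]. *)
  have [+ _] := colI _ _ (sc (1, 0)); rewrite lE /= mulr1 => l1.
  by apply/permP => -[x y]; rewrite lE l1 !mul1r perm1.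
move=> m c cP cD; rewrite ltnNge; apply/negP => mq.
have S_neq1 := card_slopes_neq1 pq stab'.
(* For [q = 3] the set [S] would be a singleton. *)
have q4 : (3 < q)%N.
  by move: q3; rewrite leq_eqVlt => /orP[/eqP e|//]; move: S_neq1; rewrite cS -e.
have maxF (A : {set 'F_q}) : (#|A| <= q)%N by rewrite -[leqRHS]cF max_card.
pose C i := [set x | c x == i].
have Cind i : {in C i &, forall x y, ~~ GS S x y}.
  move=> x y; rewrite !inE => /eqP <- /eqP e.
  by apply/negP => /cP; rewrite e.
have [s sS] : exists s, s \in S by apply/card_gt0P; rewrite cS; lia.
have Cle i : (#|C i| <= q)%N.
  by rewrite -(card_in_imset (independent_proj_inj (Cind i) sS)) maxF.
have cT : (\sum_(i < m) #|C i| = q * q)%N.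
  have <- : #|{: 'F_q * 'F_q}| = (q * q)%N by rewrite card_prod cF.
  rewrite -[RHS]sum1_card.
  rewrite [RHS](partition_big c xpredT) //=; apply: eq_bigr => i _.
  by rewrite -sum1_card; apply: eq_bigl => x; rewrite inE.
(* At most [q] classes of at most [q] points cover [q * q] points, so all are full. *)
have Ceq i : #|C i| = q.
  apply/eqP; rewrite eqn_leq Cle leqNgt; apply/negP => lt.
  have : (\sum_(j < m) #|C j| < \sum_(j < m) q)%N.
    rewrite (bigD1 i) //= [ltnRHS](bigD1 i) //= -addSn leq_add //.
    exact: leq_sum.
  by rewrite cT sum_nat_const card_ord ltn_mul2r => /andP[_]; rewrite ltnNge mq.
have line i : exists d t, C i = [set x | proj d x == t].
  have [d [t dt]] := independent_set_is_line pq q4 cS stab' (Ceq i) (Cind i).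
  exists d, t; apply/eqP; rewrite eqEcard Ceq; apply/andP; split.
    by apply/subsetP => x /dt e; rewrite inE e.
  have [d' dd'] : exists d', d' != d.
    by case: (d) => [y|]; [exists None | exists (Some 0)].
  rewrite -(card_in_imset (f := proj d')) ?maxF // => x y.
  rewrite !inE => /eqP xt /eqP yt e; apply: (proj_pair_inj dd' e).
  by rewrite xt yt.
have [d [t Cd]] := line (c (0, 0)).
have Cpar i : exists t, C i = [set x | proj d x == t].
  have [->|ine] := eqVneq i (c (0, 0)); first by exists t.
  (* Lines of different directions meet, whereas distinct colour classes are disjoint. *)
  have [d' [t' Ci]] := line i; have [<-|dd] := eqVneq d' d; first by exists t'.
  exfalso.
  have psiI : injective (fun x : 'F_q * 'F_q => (proj d' x, proj d x)).
    by move=> x y [e1 e2]; apply: proj_pair_inj e1 e2.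
  pose x := invF psiI (t', t).
  have [x1 x2] : proj d' x = t' /\ proj d x = t.
    by have := f_invF psiI (t', t); rewrite -/x => -[].
  have xi : x \in C i by rewrite Ci inE x1.
  have x0 : x \in C (c (0, 0)) by rewrite Cd inE x2.
  by move: xi x0 ine; rewrite !inE => /eqP -> /eqP ->; rewrite eqxx.
(* A nonzero vector along the lines of direction [d], that is, in the kernel of [proj d]. *)
pose w : 'F_q * 'F_q := if d is Some y then (1, y) else (0, 1).
have wd x : proj d (x.1 + w.1, x.2 + w.2) = proj d x.
  by rewrite /w; case: (d) => [y|]; rewrite /proj /=; ring.
have [f fA fE] := aut_translate S w.
have f1 : f = 1%g.
  apply: cD => // x; have [tx Cx] := Cpar (c x).
  have : x \in C (c x) by rewrite inE.
  rewrite Cx inE => /eqP xt.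
  have : f x \in C (c x) by rewrite Cx inE fE wd xt.
  by rewrite inE => /eqP.
have := fE (0, 0); rewrite f1 perm1 /w /= !add0r => e.
have := congr1 fst e; have := congr1 snd e.
by case: (d) => [y|] /= e2 e1; [move/eqP: e1 | move/eqP: e2];
  rewrite eq_sym oner_eq0.
Qed.
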